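(* Let $m,n\ge 2$ be integers. Then the eigenvalues of the Laplacian matrix of the graph $\mathcal{NC}(F_{m,n})$, listed as a multiset of $2(m+n)$ values, are: (1) $2\left(1-\cos\frac{\pi j}{n}\right)+m$ with multiplicity $2$ for each $1\le j\le n-1$; (2) $n$ with multiplicity $m-1$; (3) $n+2$ with multiplicity $m-1$; (4) $\frac{m+n}{2}+1\pm\frac{1}{2}\sqrt{m^2+2(m+2)n+n^2-4m+4}$, each with multiplicity $1$; (5) $m+n$ with multiplicity $1$; (6) $0$ with multiplicity $1$.
   Context: Graphs are finite, simple and undirected. The Laplacian matrix of a graph $G$ is $L(G)=\mathrm{Deg}(G)-A(G)$, where $A(G)$ is the adjacency matrix and $\mathrm{Deg}(G)$ is the diagonal matrix of vertex degrees. The generalized fan graph is $F_{m,n}=\overline{K}_m+P_n$, the join of the graph $\overline{K}_m$ on $m$ vertices with no edges and the path $P_n$ on $n$ vertices (all edges between the two parts are added). For $m,n\ge 2$, the graph $\mathcal{NC}(F_{m,n})$ on $2(m+n)$ vertices is obtained from two disjoint copies of $F_{m,n}$ by adding $m$ edges, joining each vertex of $\overline{K}_m$ in the first copy to the corresponding vertex of $\overline{K}_m$ in the second copy. Convention: the spectrum is described as a multiset of eigenvalues counted with multiplicity; if some listed values coincide, their multiplicities add. *)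

(* Defs.v *)
From mathcomp Require Import all_boot all_order all_algebra.
Set Implicit Arguments.
Unset Strict Implicit.
Unset Printing Implicit Defensive.
Import GRing.Theory.
Local Open Scope ring_scope.

Record sgraph := SGraph {
  vertex :> finType;
  adj : rel vertex;
  adj_sym : symmetric adj;
  adj_irrefl : irreflexive adj }.

Definition deg (G : sgraph) (u : G) : nat := #|[set v : G | adj u v]|.

(* Rows and columns follow the enumeration of the vertex type. *)
Definition adj_mx (R : pzRingType) (G : sgraph) : 'M[R]_#|{: G}| :=
  \matrix_(i, j) (adj (enum_val i : G) (enum_val j : G))%:R.

Definition deg_mx (R : pzRingType) (G : sgraph) : 'M[R]_#|{: G}| :=
  diag_mx (\row_i (deg (enum_val i : G))%:R).

Definition laplacian (R : pzRingType) (G : sgraph) : 'M[R]_#|{: G}| :=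
  deg_mx R G - adj_mx R G.

(* s lists all the eigenvalues of A with their algebraic multiplicities; in
   particular char_poly A splits over R and size s = p. *)
Definition is_spectrum (R : comNzRingType) (p : nat) (A : 'M[R]_p) (s : seq R)
  : Prop := char_poly A = \prod_(a <- s) ('X - a%:P).

Definition edgeless_rel (m : nat) : rel 'I_m := fun _ _ => false.

Lemma edgeless_sym m : symmetric (@edgeless_rel m).
Proof. by []. Qed.

Lemma edgeless_irrefl m : irreflexive (@edgeless_rel m).
Proof. by []. Qed.

Definition edgeless (m : nat) : sgraph :=
  SGraph (@edgeless_sym m) (@edgeless_irrefl m).

Definition path_rel (n : nat) : rel 'I_n :=
  fun i j => (i.+1 == j :> nat) || (j.+1 == i :> nat).

Lemma path_sym n : symmetric (@path_rel n).
Proof. by move=> i j; rewrite /path_rel orbC. Qed.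

Lemma path_irrefl n : irreflexive (@path_rel n).
Proof. by move=> i; rewrite /path_rel orbb gtn_eqF. Qed.

Definition path_graph (n : nat) : sgraph :=
  SGraph (@path_sym n) (@path_irrefl n).

Definition join_rel (G H : sgraph) : rel (G + H)%type := fun u v =>
  match u, v with
  | inl x, inl y => adj x y
  | inr x, inr y => adj x y
  | _, _ => true
  end.

Lemma join_sym G H : symmetric (@join_rel G H).
Proof. by move=> [x|x] [y|y] //=; rewrite adj_sym. Qed.

Lemma join_irrefl G H : irreflexive (@join_rel G H).
Proof. by move=> [x|x] /=; rewrite adj_irrefl. Qed.

Definition join (G H : sgraph) : sgraph :=
  SGraph (@join_sym G H) (@join_irrefl G H).

Definition fan (m n : nat) : sgraph := join (edgeless m) (path_graph n).

Definition is_hub (m n : nat) (u : fan m n) : bool :=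
  if u is inl _ then true else false.

(* The boolean component says which of the two copies of the fan a vertex
   belongs to. *)
Definition NC_rel (m n : nat) : rel (bool * fan m n)%type := fun u v =>
  if u.1 == v.1 then adj u.2 v.2 else is_hub u.2 && (u.2 == v.2).

Lemma NC_sym m n : symmetric (@NC_rel m n).
Proof.
move=> [b u] [c v]; rewrite /NC_rel /= (eq_sym c).
case: (b == c); first exact: join_sym.
by rewrite (eq_sym v); case: eqP => [->|_]; rewrite ?andbF.
Qed.

Lemma NC_irrefl m n : irreflexive (@NC_rel m n).
Proof. by move=> [b u]; rewrite /NC_rel eqxx; apply: join_irrefl. Qed.

Definition NC (m n : nat) : sgraph := SGraph (@NC_sym m n) (@NC_irrefl m n).

Lemma card_NC m n : #|{: NC m n}| = (2 * (m + n))%N.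
Proof. by rewrite card_prod card_bool card_sum !card_ord. Qed.

(* Main.v *)
Require Import Defs.
From mathcomp Require Import all_boot all_order all_algebra.
From mathcomp Require Import reals trigo.
From mathcomp Require Import ring lra zify.
Set Implicit Arguments.
Unset Strict Implicit.
Unset Printing Implicit Defensive.
Import GRing.Theory Num.Theory.
Local Open Scope ring_scope.

(** The proof exhibits an explicit orthogonal eigenbasis of the Laplacian.

    The exchange of the two copies of the fan is an automorphism of the graph,
    so the Laplacian preserves the symmetric and the antisymmetric functions.
    A function of either kind is determined by its restriction [h] to one
    copy, and there the Laplacian acts as that of the fan, plus [e * h] at the
    hubs: an edge between two copies of a hub contributes [h - h = 0] in the
    symmetric case and [h - (- h) = 2 * h] in the antisymmetric one, so that
    [e = 0], respectively [e = 2] ([lap_op_NC]).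

    On the fan, in either sector, the operator preserves three spaces
    ([fan_mode_eigen]):
    - functions supported on the path and of sum zero: the hubs do not see
      them, and each path vertex gains [m] neighbours on which they vanish, so
      the eigenvalues are those of the path shifted by [m];
    - functions supported on the hubs and of sum zero, with the single
      eigenvalue [n + e];
    - functions constant on the hubs and constant on the path, where the
      operator is a 2 by 2 matrix of trace [m + n + e] and determinant [e * m];
      its eigenvalues are [m + n] and [0] when [e = 0], and the two values with
      the square root when [e = 2].

    The discrete cosines [cos (k t (j + 1/2))], [t = pi / n], form an
    orthogonal eigenbasis of the path ([path_mode_eigen],
    [path_mode_orthogonal]) whose member [k = 0] is constant. Hence those with
    [k <> 0] span the functions of sum zero, and they serve on the path and,
    with [m] in place of [n], also on the hubs, where any orthogonal basis would
    do. The basis of the whole graph is therefore indexed by the vertices of the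
    graph itself, which is the form that [laplacian_orthogonal_spectrum] turns
    into a factorization of the characteristic polynomial with the right
    multiplicities. *)

(** * Laplacians and orthogonal families of eigenfunctions *)

(** As an operator on functions, the Laplacian is free of the enumeration of
    the vertices and of their degrees, so it splits along sums and products of
    vertex types ([laplacian_mulE] relates it to the matrix). *)
Definition lap_op (R : pzRingType) (G : sgraph) (f : G -> R) (u : G) : R :=
  \sum_v (adj u v)%:R * (f u - f v).

Lemma laplacian_mulE (R : comNzRingType) (G : sgraph) (f : G -> R) u :
  \sum_k laplacian R G (enum_rank u) k * f (enum_val k) = lap_op f u.
Proof.
under eq_bigr => k _ do rewrite /laplacian !mxE !enum_rankK mulrBl.
rewrite sumrB /lap_op.
under [RHS]eq_bigr => v _ do rewrite mulrBr.
rewrite sumrB; congr (_ - _); last first.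
  by rewrite [RHS](reindex _ (onW_bij _ (enum_val_bij _))).
rewrite (bigD1 (enum_rank u)) //= eqxx mulr1n !enum_rankK big1 => [|k]; last first.
  by rewrite eq_sym => /negPf->; rewrite mulr0n mul0r.
rewrite addr0 -mulr_suml; congr (_ * _).
rewrite /deg -sum1dep_card natr_sum big_mkcond /=; apply: eq_bigr => v _.
by case: (adj u v).
Qed.

Lemma lap_op_const (R : comNzRingType) (G : sgraph) (c : R) (u : G) :
  lap_op (fun=> c) u = 0.
Proof. by rewrite /lap_op big1 // => v _; rewrite subrr mulr0. Qed.

Lemma lap_op_sym (R : comNzRingType) (G : sgraph) (f g : G -> R) :
  \sum_u lap_op f u * g u = \sum_u f u * lap_op g u.
Proof.
apply/eqP; rewrite -subr_eq0 -sumrB.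
pose a u v : R := (adj u v)%:R * (f u * g v).
rewrite (eq_bigr (fun u => \sum_v (a u v - a v u))) => [|u _]; last first.
  rewrite /lap_op mulr_suml mulr_sumr -sumrB; apply: eq_bigr => v _.
  by rewrite /a [adj v u]adj_sym; ring.
under eq_bigr do rewrite sumrB.
by rewrite sumrB exchange_big subrr.
Qed.

(** The usual argument for a symmetric operator: both [a] and [b] can be
    pulled out of the same sum. *)
Lemma eigenfunctions_orthogonal (R : idomainType) (G : sgraph) (f g : G -> R)
    (a b : R) :
  lap_op f =1 (fun u => a * f u) -> lap_op g =1 (fun u => b * g u) ->
  a != b -> \sum_u f u * g u = 0.
Proof.
move=> fa gb neq_ab; have := lap_op_sym f g.
under eq_bigr do rewrite fa -mulrA.
under [RHS]eq_bigr do rewrite gb mulrCA.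
rewrite -!mulr_sumr => /eqP; rewrite -subr_eq0 -mulrBl mulf_eq0 subr_eq0.
by rewrite (negPf neq_ab) => /eqP.
Qed.

(** The relation [A *m V = V *m B] persists for the matrices ['X - A] and
    ['X - B], and the determinant of [V] cancels. *)
Lemma char_poly_intertwine (F : idomainType) (p : nat) (A B V : 'M[F]_p) :
  \det V != 0 -> A *m V = V *m B -> char_poly A = char_poly B.
Proof.
move=> detV AV; have detV' : \det (map_mx polyC V) != 0.
  by rewrite det_map_mx polyC_eq0.
apply: (mulIf detV'); rewrite /char_poly -[LHS]det_mulmx.
rewrite [RHS]mulrC -[RHS]det_mulmx /char_poly_mx mulmxBl mulmxBr.
by rewrite -!map_mxM AV scalar_mxC.
Qed.

(** Let [V] have the [f k] as its columns. Then [V^T *m V] is diagonal by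
    orthogonality, with nonzero sums of squares on the diagonal, so [V] is
    nonsingular; and it intertwines the Laplacian with the diagonal matrix of
    the [l k]. Indexing the family by the vertices makes [V] square. *)
Lemma laplacian_orthogonal_spectrum (R : realFieldType) (G : sgraph)
    (f : G -> G -> R) (l : G -> R) :
  (forall k u, lap_op (f k) u = l k * f k u) ->
  (forall k, exists u, f k u != 0) ->
  (forall k k', k != k' -> \sum_u f k u * f k' u = 0) ->
  char_poly (laplacian R G) = \prod_k ('X - (l k)%:P).
Proof.
move=> eig nz orth.
pose V : 'M[R]_#|{: G}| := \matrix_(i, j) f (enum_val j) (enum_val i).
pose d := \row_(i < #|{: G}|) l (enum_val i).
pose q := \row_(i < #|{: G}|) \sum_u f (enum_val i) u ^+ 2.
have VV : V^T *m V = diag_mx q.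
  apply/matrixP => i j; rewrite !mxE.
  under eq_bigr do rewrite !mxE.
  transitivity (\sum_u f (enum_val i) u * f (enum_val j) u).
    by rewrite [RHS](reindex _ (onW_bij _ (enum_val_bij _))).
  have [->|neq_ij] := eqVneq i j; first by rewrite mulr1n.
  by rewrite mulr0n orth // (inj_eq enum_val_inj).
have detV : \det V != 0.
  apply: contraTneq isT => detV0; have := congr1 determinant VV.
  rewrite det_mulmx detV0 mulr0 det_diag => /esym/eqP/prodf_eq0[i _].
  rewrite mxE psumr_eq0 => [/allP fi0|u _]; last exact: sqr_ge0.
  have [u] := nz (enum_val i); have := fi0 u (mem_index_enum u).
  by rewrite /= sqrf_eq0 => ->.
have LV : laplacian R G *m V = V *m diag_mx d.
  rewrite mul_mx_diag; apply/matrixP => i j; rewrite !mxE mulrC -eig.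
  rewrite -laplacian_mulE enum_valK; apply: eq_bigr => k _.
  by rewrite !mxE.
rewrite (char_poly_intertwine detV LV) char_poly_trig; last exact/diag_mx_is_trig.
rewrite [RHS](reindex _ (onW_bij _ (enum_val_bij _))).
by apply: eq_bigr => i _; rewrite !mxE eqxx.
Qed.

(** * The discrete cosine basis of a path *)

(** The values [g 0] and [g n.+1] are those of two fictitious vertices glued to
    the ends of the path. When [g] takes the same value at an end and at the
    vertex glued to it, the extra edges contribute nothing, and the operator is
    the second difference at every vertex, without boundary cases. *)
Lemma lap_op_path (R : comNzRingType) (n : nat) (g : nat -> R) (i : 'I_n) :
  g 0 = g 1 -> g n = g n.+1 ->
  lap_op (G := path_graph n) (fun j : 'I_n => g j.+1) i =
    (g i.+1 - g i) + (g i.+1 - g i.+2).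
Proof.
move=> g01 gn; rewrite /lap_op /= /path_rel.
rewrite (eq_bigr (fun j : 'I_n => (j.+1 == i :> nat)%:R * (g i.+1 - g j.+1)
  + (i.+1 == j :> nat)%:R * (g i.+1 - g j.+1))) => [|j _]; last first.
  rewrite -mulrDl -natrD; congr (_%:R * _).
  by case: eqP => [<-|_]; case: eqP => //; lia.
rewrite big_split /=; congr (_ + _).
  have [i0|i_gt0] := posnP i.
    by rewrite big1 => [|j _]; rewrite i0 ?mul0r // g01 subrr.
  have lt_i : (i.-1 < n)%N by have := ltn_ord i; lia.
  rewrite (bigD1 (Ordinal lt_i)) //= prednK // eqxx mul1r big1 ?addr0 // => j.
  by rewrite -val_eqE /= => /eqP nj; case: eqP => [|_]; rewrite ?mul0r //; lia.
have [lt_i|le_i] := ltnP i.+1 n.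
  rewrite (bigD1 (Ordinal lt_i)) //= eqxx mul1r big1 ?addr0 // => j.
  by rewrite -val_eqE /= eq_sym => /negPf->; rewrite mul0r.
have -> : i.+1 = n by have := ltn_ord i; lia.
by rewrite gn subrr big1 // => j _; rewrite gtn_eqF ?mul0r.
Qed.

(** The half-integer offset centres the cosine on the edge between vertex 0
    (index 1 in [lap_op_path]) and its fictitious neighbour. *)
Definition path_mode (R : realType) (n : nat) (k j : 'I_n) : R :=
  cos (pi * k%:R / n%:R * (j.+1%:R - 1 / 2)).

Section PathModes.
Variables (R : realType) (n : nat).
Implicit Types k j : 'I_n.

(** The second difference of [cos (t x)] is [2 (1 - cos t) cos (t x)]. The
    boundary conditions of [lap_op_path] hold because the cosine is symmetric
    about [0] and, as [t n] is a multiple of [pi], also about [t n]. *)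
Lemma path_mode_eigen k :
  lap_op (G := path_graph n) (@path_mode R n k) =1
  (fun j => 2 * (1 - cos (pi * k%:R / n%:R)) * path_mode R k j).
Proof.
move=> j; set t := pi * k%:R / n%:R.
have n0 : n%:R != 0 :> R by rewrite pnatr_eq0; have := ltn_ord k; lia.
pose g (x : nat) : R := cos (t * (x%:R - 1 / 2)).
(* The cosine is even about [t n = pi k] because the sine vanishes there. *)
have sin_pik : sin (pi * k%:R) = 0 :> R.
  elim: (nat_of_ord k) => [|x IHx]; first by rewrite mulr0 sin0.
  by rewrite -natr1 mulrDr mulr1 sinDpi IHx oppr0.
have g01 : g 0 = g 1.
  by rewrite /g -[LHS]cosN; congr cos; field.
have gn : g n = g n.+1.
  have tn : t * n%:R = pi * k%:R by rewrite /t divfK.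
  rewrite /g -[n.+1%:R]natr1.
  have -> : t * (n%:R - 1 / 2) = pi * k%:R - t / 2 by rewrite -tn; field.
  have -> : t * (n%:R + 1 - 1 / 2) = pi * k%:R + t / 2 by rewrite -tn; field.
  by rewrite cosB cosD sin_pik !mul0r addr0 subr0.
rewrite (lap_op_path j g01 gn) /path_mode -/t -/(g j.+1).
have -> : g j = cos (t * (j.+1%:R - 1 / 2) - t).
  by rewrite /g -[j.+1%:R]natr1; congr cos; ring.
have -> : g j.+2 = cos (t * (j.+1%:R - 1 / 2) + t).
  by rewrite /g -[j.+2%:R]natr1; congr cos; ring.
by rewrite cosB cosD /g; ring.
Qed.

Lemma path_mode_orthogonal k k' : k != k' ->
  \sum_j path_mode R k j * path_mode R k' j = 0.
Proof.
move=> neq; apply: (eigenfunctions_orthogonal (path_mode_eigen k) (path_mode_eigen k')).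
apply: contra neq => /eqP eq_l.
have n0 : 0 < n%:R :> R by rewrite ltr0n; have := ltn_ord k; lia.
(* Distinct modes have distinct eigenvalues: the cosine is injective on [0, pi]. *)
have in_0pi (x : 'I_n) : (pi * x%:R / n%:R : R) \in `[0, pi].
  rewrite in_itv /= divr_ge0 ?mulr_ge0 ?pi_ge0 ?ler0n //=.
  by rewrite ler_pdivrMr // ler_pM2l ?pi_gt0 // ler_nat ltnW.
have /(cos_inj (in_0pi k) (in_0pi k')) : cos (pi * k%:R / n%:R) = cos (pi * k'%:R / n%:R) :> R by lra.
move/(divIf (lt0r_neq0 n0))/(mulfI (lt0r_neq0 (pi_gt0 R)))/eqP.
by rewrite eqr_nat.
Qed.

Lemma path_mode0 k j : k = 0%N :> nat -> path_mode R k j = 1.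
Proof. by rewrite /path_mode => ->; rewrite mulr0 !mul0r cos0. Qed.

(** For [k <> 0] this is orthogonality to the constant mode. *)
Lemma sum_path_mode k :
  \sum_j path_mode R k j = (k == 0%N :> nat)%:R * n%:R.
Proof.
case: eqP => [k0|k0].
  under eq_bigr do rewrite path_mode0 //.
  by rewrite sumr_const card_ord mul1r.
have n_gt0 : (0 < n)%N by have := ltn_ord k; lia.
rewrite mul0r -[RHS](@path_mode_orthogonal k (Ordinal n_gt0)); last first.
  by rewrite -val_eqE; apply/eqP.
by apply: eq_bigr => j _; rewrite (@path_mode0 (Ordinal n_gt0)) ?mulr1.
Qed.

(** At vertex 0 the argument of the cosine is [pi k / (2 n) < pi / 2]. *)
Lemma path_mode_neq0 k : exists j, path_mode R k j != 0.
Proof.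
have n_gt0 : (0 < n)%N by have := ltn_ord k; lia.
have n0 : 0 < n%:R :> R by rewrite ltr0n.
exists (Ordinal n_gt0); apply/lt0r_neq0/cos_gt0_pihalf.
have -> : pi * k%:R / n%:R * (1 - 1 / 2) = pi / 2 * (k%:R / n%:R) :> R by field; lra.
have pi0 := pi_gt0 R.
have r0 : 0 <= k%:R / n%:R :> R by rewrite divr_ge0.
have r1 : k%:R / n%:R < 1 :> R by rewrite ltr_pdivrMr // mul1r ltr_nat.
by apply/andP; split; nra.
Qed.

End PathModes.

(** * The two sectors and the operator on a fan *)

Definition fan_fun (R : Type) (m n : nat) (x : 'I_m -> R) (y : 'I_n -> R)
  (u : fan m n) : R :=
  match u with inl i => x i | inr j => y j end.

Lemma lap_op_fan (R : comNzRingType) (m n : nat) (x : 'I_m -> R)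
    (y : 'I_n -> R) (u : fan m n) :
  lap_op (fan_fun x y) u =
  match u with
  | inl i => n%:R * x i - \sum_j y j
  | inr j => lap_op (G := path_graph n) y j + m%:R * y j - \sum_i x i
  end.
Proof.
rewrite /lap_op big_sumType /=; case: u => [i|j] /=.
  rewrite big1 => [|i' _]; last by rewrite mul0r.
  under eq_bigr do rewrite mul1r.
  by rewrite sumrB sumr_const card_ord add0r mulr_natl.
rewrite addrC -addrA; congr (_ + _).
under eq_bigr do rewrite mul1r.
by rewrite sumrB sumr_const card_ord mulr_natl.
Qed.

(** [s] distinguishes the antisymmetric sector ([true]) from the symmetric
    one. *)
Definition twist (R : pzRingType) (T : Type) (s : bool) (h : T -> R) (v : bool * T) : R :=
  (-1) ^+ (s && v.1) * h v.2.

(** The edge between the two copies of a hub contributes [h - h] if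
    [s = false], and [h - (- h)] if [s = true]. *)
Lemma lap_op_NC (R : comNzRingType) (m n : nat) (s : bool)
    (h : fan m n -> R) (v : NC m n) :
  lap_op (twist s h : NC m n -> R) v =
    (-1) ^+ (s && v.1) *
      (lap_op h v.2 + (is_hub v.2)%:R * (s%:R * 2 * h v.2)).
Proof.
case: v => b u /=; rewrite /lap_op.
rewrite -(pair_bigA _ (fun c w => (@adj (NC m n) (b, u) (c, w))%:R *
  (twist s h (b, u) - twist s h (c, w)))) /=.
rewrite big_bool /NC_rel /twist /=.
have same c : \sum_(w : fan m n) (adj u w)%:R *
    ((-1) ^+ (s && c) * h u - (-1) ^+ (s && c) * h w) =
    (-1) ^+ (s && c) * \sum_(w : fan m n) (adj u w)%:R * (h u - h w).
  by rewrite mulr_sumr; apply: eq_bigr => w _; ring.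
have cross (a c : R) : \sum_(w : fan m n) (is_hub u && (u == w))%:R *
    (a * h u - c * h w) = (is_hub u)%:R * ((a - c) * h u).
  rewrite (bigD1 u) //= eqxx andbT big1 => [|w]; first by rewrite addr0 mulrBl.
  by rewrite eq_sym => /negPf->; rewrite andbF mul0r.
by case: b; rewrite /= same cross; clear same; case: s => /=;
  rewrite ?expr0 ?expr1; ring.
Qed.


(** On functions equal to [a] on the hubs and to [b] on the path, the operator
    sends [(a, b)] to [((n + e) a - n b, m b - m a)]. The second coordinate
    makes [(m - r, m)] the eigenvector for [r]; the first one then says that
    [r] is a root of the characteristic polynomial. *)
Lemma fan_quotient_eigen (R : comNzRingType) (m n : nat) (e r : R)
    (u : fan m n) :
  r ^+ 2 = (m%:R + n%:R + e) * r - e * m%:R ->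
  let h := fan_fun (fun=> m%:R - r) (fun=> m%:R) in
  lap_op h u + (is_hub u)%:R * (e * h u) = r * h u.
Proof.
move=> q h; rewrite /h lap_op_fan; case: u => [i|j] /=.
  rewrite sumr_const card_ord -mulr_natl mulr1n mul1r [RHS]mulrBr -expr2 q.
  ring.
by rewrite lap_op_const sumr_const card_ord -mulr_natl mulr0n mul0r; ring.
Qed.

(** The two sides of the fan offer one index 0 each; these two places are taken
    by the eigenvectors for [r1] and [r2] of [fan_quotient_eigen]. *)
Definition fan_mode (R : realType) (m n : nat) (r1 r2 : R) (k : fan m n)
    : fan m n -> R :=
  match k with
  | inl k => if k == 0%N :> nat then fan_fun (fun=> m%:R - r1) (fun=> m%:R)
             else fan_fun (path_mode R k) (fun=> 0)
  | inr k => if k == 0%N :> nat then fan_fun (fun=> m%:R - r2) (fun=> m%:R)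
             else fan_fun (fun=> 0) (path_mode R k)
  end.

Definition fan_eigenvalue (R : realType) (m n : nat) (e r1 r2 : R)
    (k : fan m n) : R :=
  match k with
  | inl k => if k == 0%N :> nat then r1 else n%:R + e
  | inr k => if k == 0%N :> nat then r2
             else 2 * (1 - cos (pi * k%:R / n%:R)) + m%:R
  end.

(** By Vieta, the hypotheses say that [r1] and [r2] are the eigenvalues of the
    2 by 2 matrix of [fan_quotient_eigen]. *)
Lemma fan_mode_eigen (R : realType) (m n : nat) (e r1 r2 : R)
    (k u : fan m n) :
  r1 + r2 = m%:R + n%:R + e -> r1 * r2 = e * m%:R ->
  lap_op (fan_mode r1 r2 k) u + (is_hub u)%:R * (e * fan_mode r1 r2 k u) =
    fan_eigenvalue e r1 r2 k * fan_mode r1 r2 k u.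
Proof.
move=> r_sum r_prod.
have q1 : r1 ^+ 2 = (m%:R + n%:R + e) * r1 - e * m%:R.
  by rewrite -r_sum -r_prod; ring.
have q2 : r2 ^+ 2 = (m%:R + n%:R + e) * r2 - e * m%:R.
  by rewrite -r_sum -r_prod; ring.
case: k => k; rewrite /fan_mode /fan_eigenvalue.
  case: eqP => [_|/eqP/negPf k0]; first exact: fan_quotient_eigen.
  rewrite lap_op_fan; case: u => [i|j] /=.
    by rewrite big1 // subr0 mulr1n mul1r mulrDl.
  by rewrite lap_op_const sum_path_mode k0 !mulr0 !mul0r subr0 !addr0.
case: eqP => [_|/eqP/negPf k0]; first exact: fan_quotient_eigen.
rewrite lap_op_fan; case: u => [i|j] /=.
  by rewrite sum_path_mode k0 mul0r !mulr0 subr0 addr0.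
by rewrite path_mode_eigen big1 // subr0 mulr0n mul0r addr0 [RHS]mulrDl.
Qed.

Lemma fan_mode_neq0 (R : realType) (m n : nat) (r1 r2 : R) (k : fan m n) :
  (0 < m)%N -> (0 < n)%N -> exists u, fan_mode r1 r2 k u != 0.
Proof.
move=> m_gt0 n_gt0.
have m0 : m%:R != 0 :> R by rewrite pnatr_eq0 -lt0n.
case: k => k; rewrite /fan_mode; case: eqP => k0.
- by exists (inr (Ordinal n_gt0)).
- by have [i] := path_mode_neq0 R k; exists (inl i).
- by exists (inr (Ordinal n_gt0)).
- by have [j] := path_mode_neq0 R k; exists (inr j).
Qed.

(** On each side of the fan, either one of the two modes vanishes, or a mode of
    sum zero meets a constant, or two different cosines meet. What remains is
    the pair of modes constant on each side, whose product
    [m (m - r1) (m - r2) + n m^2] is zero by the relations on [r1] and [r2]. *)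
Lemma fan_mode_orthogonal (R : realType) (m n : nat) (e r1 r2 : R)
    (k k' : fan m n) :
  r1 + r2 = m%:R + n%:R + e -> r1 * r2 = e * m%:R -> k != k' ->
  \sum_u fan_mode r1 r2 k u * fan_mode r1 r2 k' u = 0.
Proof.
move=> r_sum r_prod.
have quotient : \sum_(i < m) (m%:R - r1) * (m%:R - r2) +
    \sum_(j < n) m%:R * m%:R = 0 :> R.
  rewrite !sumr_const !card_ord -[(_ * _) *+ m]mulr_natl -[(_ * _) *+ n]mulr_natl.
  have -> : (m%:R - r1) * (m%:R - r2)
    = m%:R ^+ 2 - m%:R * (r1 + r2) + r1 * r2 :> R by ring.
  by rewrite r_sum r_prod; ring.
have sum0 p (l : 'I_p) : l <> 0%N :> nat -> \sum_j path_mode R l j = 0.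
  by move/eqP/negPf => l0; rewrite sum_path_mode l0 mul0r.
have index0_inj p (l l' : 'I_p) : l = 0%N :> nat -> l' = 0%N :> nat -> l = l'.
  by move=> l0 l'0; apply/val_inj; rewrite /= l0.
have sum_0l p (G : 'I_p -> R) : \sum_i 0 * G i = 0.
  by rewrite big1 // => i _; rewrite mul0r.
have sum_0r p (G : 'I_p -> R) : \sum_i G i * 0 = 0.
  by rewrite big1 // => i _; rewrite mulr0.
rewrite big_sumType /fan_mode.
case: k => k; case: k' => k' neq; case: eqP => k0; case: eqP => k'0 /=.
- by rewrite (index0_inj _ _ _ k0 k'0) eqxx in neq.
- by rewrite sum_0r addr0 -mulr_sumr sum0 ?mulr0.
- by rewrite sum_0l addr0 -mulr_suml sum0 ?mul0r.
- rewrite sum_0l addr0; apply: path_mode_orthogonal.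
  by apply: contraNneq neq => ->.
- exact: quotient.
- by rewrite sum_0r add0r -mulr_sumr sum0 ?mulr0.
- by rewrite sum_0l addr0 -mulr_suml sum0 ?mul0r.
- by rewrite sum_0l sum_0r addr0.
- by rewrite -[RHS]quotient; congr (_ + _); apply: eq_bigr => i _; rewrite mulrC.
- by rewrite sum_0r addr0 -mulr_sumr sum0 ?mulr0.
- by rewrite sum_0l add0r -mulr_suml sum0 ?mul0r.
- by rewrite sum_0l sum_0r addr0.
- by rewrite (index0_inj _ _ _ k0 k'0) eqxx in neq.
- by rewrite sum_0r add0r -mulr_sumr sum0 ?mulr0.
- by rewrite sum_0l add0r -mulr_suml sum0 ?mul0r.
- rewrite sum_0l add0r; apply: path_mode_orthogonal.
  by apply: contraNneq neq => ->.
Qed.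

(** Functions in different sectors are orthogonal whatever [h] and [h'] are:
    the contributions of the two copies have opposite signs. *)
Lemma sum_twist_mul (R : comNzRingType) (m n : nat) (s s' : bool)
    (h h' : fan m n -> R) :
  \sum_(v : NC m n) twist s h v * twist s' h' v =
    ((s == s')%:R * 2) * \sum_u h u * h' u.
Proof.
rewrite -(pair_bigA _ (fun b u => twist s h (b, u) * twist s' h' (b, u))) /=.
have part b : \sum_u twist s h (b, u) * twist s' h' (b, u) =
    (-1) ^+ (s && b) * (-1) ^+ (s' && b) * \sum_u h u * h' u.
  by rewrite mulr_sumr; apply: eq_bigr => u _; rewrite /twist /=; ring.
rewrite big_bool /= !part !andbT !andbF -mulrDl; congr (_ * _).
by clear part; case: s; case: s' => /=; rewrite ?expr0 ?expr1; ring.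
Qed.

Lemma prod_fan_eigenvalue (R : realType) (m n : nat) (e r1 r2 : R) :
  (0 < m)%N -> (0 < n)%N ->
  \prod_(k : fan m n) ('X - (fan_eigenvalue e r1 r2 k)%:P) =
    ('X - r1%:P) * ('X - (n%:R + e)%:P) ^+ m.-1 * ('X - r2%:P) *
    \prod_(j <- iota 1 n.-1)
      ('X - (2 * (1 - cos (pi * j%:R / n%:R)) + m%:R)%:P).
Proof.
case: m n => [|m] [|n] // _ _; rewrite big_sumType /= !big_ord_recl /=.
rewrite prodr_const card_ord -!mulrA; congr (_ * (_ * (_ * _))).
rewrite -[iota 1 n]/(iota (1 + 0) n) iotaDl big_map -[n in iota 0 n]subn0.
by rewrite big_mkord.
Qed.

Theorem theorem3p7 (R : realType) (m n : nat) (hm : (2 <= m)%N) (hn : (2 <= n)%N) :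
  let mr : R := m%:R in
  let nr : R := n%:R in
  let D : R := Num.sqrt (mr ^+ 2 + 2 * (mr + 2) * nr + nr ^+ 2 - 4 * mr + 4) in
  is_spectrum (laplacian R (NC m n))
    (flatten [seq nseq 2 (2 * (1 - cos (pi * j%:R / nr)) + mr)
             | j <- iota 1 n.-1]
     ++ nseq m.-1 nr
     ++ nseq m.-1 (nr + 2)
     ++ [:: (mr + nr) / 2 + 1 + 1 / 2 * D;
            (mr + nr) / 2 + 1 - 1 / 2 * D;
            mr + nr;
            0]).
Proof.
move=> mr nr D; rewrite /is_spectrum.
(* The radicand is nonnegative, being [(m + n - 2)^2 + 8 n]. *)
have DD : D ^+ 2 = mr ^+ 2 + 2 * (mr + 2) * nr + nr ^+ 2 - 4 * mr + 4.
  rewrite sqr_sqrtr //.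
  have -> : mr ^+ 2 + 2 * (mr + 2) * nr + nr ^+ 2 - 4 * mr + 4 =
    (mr + nr - 2) ^+ 2 + 8 * nr by ring.
  by rewrite addr_ge0 ?sqr_ge0 ?mulr_ge0 ?ler0n.
pose r1 (s : bool) := if s then (mr + nr) / 2 + 1 + 1 / 2 * D else mr + nr.
pose r2 (s : bool) := if s then (mr + nr) / 2 + 1 - 1 / 2 * D else 0.
have r_sum s : r1 s + r2 s = mr + nr + s%:R * 2.
  by case: s; rewrite /r1 /r2 /=; field.
have r_prod s : r1 s * r2 s = s%:R * 2 * mr.
  case: s; rewrite /r1 /r2 /=; last by ring.
  have -> : ((mr + nr) / 2 + 1 + 1 / 2 * D) * ((mr + nr) / 2 + 1 - 1 / 2 * D) =
    ((mr + nr + 2) ^+ 2 - D ^+ 2) / 4 by field.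
  by rewrite DD; field.
have m_gt0 : (0 < m)%N by apply: ltnW.
have n_gt0 : (0 < n)%N by apply: ltnW.
rewrite (@laplacian_orthogonal_spectrum _ _
  (fun k : NC m n => twist k.1 (fan_mode (r1 k.1) (r2 k.1) k.2))
  (fun k : NC m n => fan_eigenvalue (k.1%:R * 2) (r1 k.1) (r2 k.1) k.2)).
- rewrite -(pair_bigA _ (fun (s : bool) (k : fan m n) =>
    'X - (fan_eigenvalue (s%:R * 2) (r1 s) (r2 s) k)%:P)) /=.
  rewrite big_bool /= !prod_fan_eigenvalue //.
  rewrite !big_cat !big_cons big_nil big_flatten big_map !big_nseq !iter_mulr_1.
  under [in RHS]eq_bigr do rewrite !big_cons big_nil /= mulr1.
  rewrite big_split /= -/mr -/nr mulr1n mulr0n !mul1r mul0r addr0 mulr1.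
  set P := \prod_(_ <- _) _; set A := _ ^+ m.-1; set B := _ ^+ m.-1.
  by ring.
- move=> [s k] [b u].
  by rewrite lap_op_NC fan_mode_eigen ?r_sum ?r_prod //= /twist mulrCA.
- move=> [s k]; have [u nz] := fan_mode_neq0 (r1 s) (r2 s) k m_gt0 n_gt0.
  by exists (false, u); rewrite /twist /= andbF mul1r.
- move=> [s k] [s' k'] neq; rewrite sum_twist_mul /=.
  have [eq_s|_] := eqVneq s s'; last by rewrite !mul0r.
  move: neq; rewrite -eq_s => neq.
  rewrite (fan_mode_orthogonal (r_sum s) (r_prod s)) ?mulr0 //.
  by apply: contraNneq neq => ->.
Qed.
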